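(* Let $p$ be a prime, $s\ge1$, and $n\geq 2m\ge 4$. (i) The clique number of $G_{p^s}(n,m)$ is $$\omega\left(G_{p^s}(n,m)\right)=p^{(s-1)(n-m)}{n-m+1\brack 1}_p.$$ (ii) Let $\mathcal{M}$ be a maximum clique of $G_{p^s}(n,m)$ and let $\pi(\mathcal{M})=\{\pi(A):A\in\mathcal{M}\}$. If $n>2m$, then $\pi(\mathcal{M})$ is a star in $G_{p}(n,m)$; if $n=2m$, then $\pi(\mathcal{M})$ is a star or a top in $G_{p}(n,m)$.
   Context: $R=\mathbb{Z}_{p^s}$; vectors are row vectors. A set $\{\alpha_1,\dots,\alpha_k\}\subseteq R^n$ is unimodular if the matrix with rows $\alpha_i$ has a right inverse over $R$. For a submodule $V\subseteq R^n$, $\dim(V)$ is the largest size of a unimodular subset of $V$. A $k$-subspace ($k\ge1$) of $R^n$ is a submodule with a unimodular basis of $k$ vectors; the $0$-subspace is $\{0\}$. A subspace is represented by a matrix whose rows form such a basis. For $1\le m<n$, the Grassmann graph $G_{p^s}(n,m)$ has vertex set the $m$-subspaces of $R^n$, with $A\sim B$ iff $A\cap B$ is a linear subset of dimension $m-1$ (for $s=1$ this is the usual Grassmann graph over the field $\mathbb{Z}_p$). A star is a set $[P\rangle_m$ of all $m$-subspaces containing a fixed $(m-1)$-subspace $P$; a top is a set $\langle Q]_m$ of all $m$-subspaces contained in a fixed $(m+1)$-subspace $Q$. The map $\pi$ is reduction modulo $p$ (entrywise, from $\mathbb{Z}_{p^s}$-matrices to $\mathbb{Z}_p$-matrices); for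 a subspace $A$ of $\mathbb{Z}_{p^s}^n$, $\pi(A)$ is the subspace of $\mathbb{Z}_p^n$ spanned by the rows of $\pi$ applied to a matrix representation of $A$. The Gaussian binomial coefficient is ${n\brack k}_q=\prod_{i=1}^k\frac{q^{n+1-i}-1}{q^i-1}$. *)

(* Defs.v *)
From HB Require Import structures.
From mathcomp Require Import all_boot all_order all_algebra.

Set Implicit Arguments.
Unset Strict Implicit.
Unset Printing Implicit Defensive.

Import GRing.Theory.

Local Open Scope ring_scope.

Section Subspaces.

Variable R : finComNzRingType.

Definition right_invertible k n (A : 'M[R]_(k, n)) : bool :=
  [exists B : 'M[R]_(n, k), A *m B == 1%:M].

(* The enumeration order of S does not affect right invertibility. *)
Definition unimodular n (S : {set 'rV[R]_n}) : bool :=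
  right_invertible (\matrix_(i < #|S|) (enum_val i : 'rV[R]_n)).

Definition submodule n (V : {set 'rV[R]_n}) : bool :=
  (0 \in V) &&
  [forall a : R, forall u in V, forall v in V, a *: u + v \in V].

Definition unimod_dim n (V : {set 'rV[R]_n}) : nat :=
  \max_(S : {set 'rV[R]_n} | (S \subset V) && unimodular S) #|S|.

Definition row_span k n (A : 'M[R]_(k, n)) : {set 'rV[R]_n} :=
  [set x *m A | x : 'rV[R]_k].

Definition basis_rows k n (A : 'M[R]_(k, n)) (V : {set 'rV[R]_n}) : bool :=
  (row_span A == V) && [forall x : 'rV[R]_k, (x *m A == 0) ==> (x == 0)].

Definition represents k n (A : 'M[R]_(k, n)) (V : {set 'rV[R]_n}) : bool :=
  basis_rows A V && right_invertible A.

(* For k = 0 the only such V is [set 0]; see subspace0. *)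
Definition subspace n (k : nat) (V : {set 'rV[R]_n}) : bool :=
  submodule V && [exists A : 'M[R]_(k, n), represents A V].

(* A matrix representation of V (arbitrary unless V is a k-subspace). *)
Definition matrix_rep n (k : nat) (V : {set 'rV[R]_n}) : 'M[R]_(k, n) :=
  odflt 0 [pick A : 'M[R]_(k, n) | represents A V].

Lemma subspace0 n (V : {set 'rV[R]_n}) : subspace 0 V = (V == [set 0]).
Proof.
have span0 (A : 'M[R]_(0, n)) : row_span A = [set 0].
  apply/setP=> v; rewrite inE; apply/imsetP/eqP => [[x _ ->]|->].
    by rewrite [A]flatmx0 mulmx0.
  by exists 0; rewrite // mul0mx.
apply/andP/eqP => [[_ /existsP[A /andP[/andP[/eqP <- _] _]]]|->].
  exact: span0.
split.
  rewrite /submodule inE eqxx; apply/forallP=> a.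
  apply/forall_inP=> u; rewrite inE => /eqP->.
  by apply/forall_inP=> v; rewrite !inE => /eqP->; rewrite scaler0 addr0.
apply/existsP; exists 0; rewrite /represents /basis_rows span0 eqxx /=.
apply/andP; split; first by apply/forallP=> x; rewrite [x]thinmx0 eqxx implybT.
by apply/existsP; exists 0; rewrite mul0mx [1%:M]flatmx0.
Qed.

End Subspaces.

Section Cliques.

Variables (T : finType) (V : {set T}) (e : rel T).

Definition clique (M : {set T}) : bool :=
  (M \subset V) && [forall A in M, forall B in M, (A != B) ==> e A B].

Definition clique_number : nat := \max_(M : {set T} | clique M) #|M|.

Definition maximum_clique (M : {set T}) : bool :=
  clique M && (#|M| == clique_number).

End Cliques.

Section GrassmannGraph.

Variables (R : finComNzRingType) (n m : nat).

Definition grass_vertices : {set {set 'rV[R]_n}} := [set V | subspace m V].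

Definition grass_adj : rel {set 'rV[R]_n} :=
  fun A B => submodule (A :&: B) && (unimod_dim (A :&: B) == (m - 1)%N).

Definition grass_clique_number : nat := clique_number grass_vertices grass_adj.

Definition grass_maximum_clique (M : {set {set 'rV[R]_n}}) : bool :=
  maximum_clique grass_vertices grass_adj M.

Definition is_star (X : {set {set 'rV[R]_n}}) : Prop :=
  exists2 P : {set 'rV[R]_n}, subspace (m - 1) P &
    X = [set V in grass_vertices | P \subset V].

Definition is_top (X : {set {set 'rV[R]_n}}) : Prop :=
  exists2 Q : {set 'rV[R]_n}, subspace (m + 1) Q &
    X = [set V in grass_vertices | V \subset Q].

End GrassmannGraph.

Section Reduction.

Variables (p s : nat).

Definition reduce (x : 'Z_(p ^ s)) : 'Z_p := (x : nat)%:R.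

Definition reduce_mx k n (A : 'M['Z_(p ^ s)]_(k, n)) : 'M['Z_p]_(k, n) :=
  map_mx reduce A.

Definition reduce_subspace n (k : nat) (V : {set 'rV['Z_(p ^ s)]_n}) :
    {set 'rV['Z_p]_n} :=
  row_span (reduce_mx (matrix_rep k V)).

Hypotheses (p_pr : prime p) (s_gt0 : (0 < s)%N).

Let p_gt1 : (1 < p)%N. Proof. exact: prime_gt1. Qed.

Let ps_gt1 : (1 < p ^ s)%N.
Proof. by rewrite -{1}(expn0 p) ltn_exp2l. Qed.

Let natr_modps a : (a %% (Zp_trunc (p ^ s)).+2)%:R = a%:R :> 'Z_p.
Proof.
by rewrite (Zp_cast ps_gt1) -Zp_nat_mod // modn_dvdm ?Zp_nat_mod // dvdn_exp.
Qed.

Lemma reduceD : {morph reduce : x y / x + y}.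
Proof.
by move=> x y; rewrite /reduce /= natr_modps natrD.
Qed.

Lemma reduceM : {morph reduce : x y / x * y}.
Proof.
by move=> x y; rewrite /reduce /= natr_modps natrM.
Qed.

Lemma reduce_mxM k l n (A : 'M_(k, l)) (B : 'M_(l, n)) :
  reduce_mx (A *m B) = reduce_mx A *m reduce_mx B.
Proof.
apply/matrixP=> i j; rewrite !mxE (big_morph _ reduceD (id1 := 0)) //.
by apply: eq_bigr => l0 _; rewrite !mxE reduceM.
Qed.

(* The reduction of a subspace does not depend on the representation. *)
Lemma reduce_subspaceE n k (V : {set 'rV['Z_(p ^ s)]_n}) (A : 'M_(k, n)) :
  represents A V -> reduce_subspace k V = row_span (reduce_mx A).
Proof.
have sub (B C : 'M_(k, n)) : represents B V -> represents C V ->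
    row_span (reduce_mx B) \subset row_span (reduce_mx C).
  move=> /andP[/andP[/eqP VB _] _] /andP[/andP[/eqP VC _] _].
  have [D BE] : exists D : 'M_k, B = D *m C.
    have h i : exists x : 'rV_k, row i B == x *m C.
      have : row i B \in row_span C.
        by rewrite VC -VB rowE; apply/imsetP; exists (delta_mx 0 i).
      by case/imsetP=> x _ ->; exists x.
    exists (\matrix_i xchoose (h i)); apply/row_matrixP=> i.
    by rewrite row_mul rowK; apply/eqP/(xchooseP (h i)).
  apply/subsetP=> _ /imsetP[x _ ->]; apply/imsetP.
  by exists (x *m reduce_mx D); rewrite // BE reduce_mxM mulmxA.
move=> AV; rewrite /reduce_subspace /matrix_rep.
case: pickP => [B BV|/(_ A)]; last by rewrite AV.
by apply/eqP; rewrite eqEsubset !sub.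
Qed.

End Reduction.

Definition gauss_binom (q n k : nat) : rat :=
  \prod_(1 <= i < k.+1) ((q%:R ^+ (n + 1 - i) - 1) / (q%:R ^+ i - 1)).

(* Main.v *)
(* Write R = Z/p^s, F = Z/p, and let I be the kernel of the reduction R ->
   F.

   Reduction maps a clique M to a clique pi(M) of the Grassmann graph over
   F, and such a clique lies in a star or in a top; counting vectors
   outside the common (m-1)-space (or, for a top, outside the orthogonal
   complement of the common (m+1)-space) bounds its size by [n-m+1, 1]_p,
   resp. [m+1, 1]_p. The members of M with a given reduction are the row
   spaces of matrices [1 | X] in suitable coordinates, with X over I and
   pairwise differences of the form u z, u a unimodular column.
   Multiplication in a degree n-m extension of F, lifted to R, gives an
   additive map from m x (n-m) matrices to R^(n-m) that kills no nonzero u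
   z, so each fibre of M -> pi(M) has at most |I|^(n-m) elements. A star
   over R attains the product of the two bounds, hence for a maximum
   clique pi(M) attains the first one and fills its star or top. *)

From HB Require Import structures.
Require Import Defs.
From mathcomp Require Import all_boot all_order all_algebra all_field.

Set Implicit Arguments.
Unset Strict Implicit.
Unset Printing Implicit Defensive.

Import GRing.Theory.
Local Open Scope ring_scope.

(** * A linear family of nonsingular matrices from a field extension *)

(* Multiplication by the elements of a basis of the field with p ^ N elements. *)
Lemma nonsingular_pencil p N m : prime p -> (0 < N)%N -> (m <= N)%N ->
  exists T : 'I_m -> 'M['F_p]_N,
    forall u : 'cV_m, u != 0 -> \sum_i u i 0 *: T i \in unitmx.
Proof.
move=> p_pr N_gt0 mN.
have [L0 pL cL] := pPrimePowerField p_pr N_gt0.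
pose L := pPrimeCharType pL.
have [f f_lin [g fK gK]] : Vector.axiom N L.
  have := @pprimeChar_vectAxiom p _ pL.
  by have -> : logn p #|pPrimeCharType pL| = N by rewrite cL pfactorK.
pose F : {linear L -> 'rV['F_p]_N} :=
  HB.pack f (GRing.isLinear.Build _ _ _ _ f f_lin).
have g_lin : linear g.
  by move=> a x y; apply: (can_inj fK); rewrite f_lin !gK.
pose G : {linear 'rV['F_p]_N -> L} :=
  HB.pack g (GRing.isLinear.Build _ _ _ _ g g_lin).
have widen_inj : injective (widen_ord mN).
  by move=> i j /(congr1 val)/= /val_inj.
(* The first [m] vectors of a coordinate basis of [L], available because [m <= N]. *)
pose e (i : 'I_m) : L := G (delta_mx 0 (widen_ord mN i)).
have mul_lin (i : 'I_m) : linear (fun x : 'rV['F_p]_N => F (e i * G x)).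
  by move=> a x y; rewrite linearP mulrDr -scalerAr linearP.
pose mulT i : {linear 'rV['F_p]_N -> 'rV['F_p]_N} :=
  HB.pack (fun x : 'rV['F_p]_N => F (e i * G x))
    (GRing.isLinear.Build _ _ _ _ _ (mul_lin i)).
exists (fun i => lin1_mx (mulT i)) => u nz_u.
(* The combination given by [u] is the matrix of multiplication by [w]. Independence of the [e i]
   makes [w] nonzero, and [L] has no zero divisors, so the kernel vanishes. *)
pose w : L := \sum_i u i 0 *: e i.
have wE (x : 'rV['F_p]_N) :
    x *m (\sum_i u i 0 *: lin1_mx (mulT i)) = F (w * G x).
  rewrite mulmx_sumr mulr_suml linear_sum; apply: eq_bigr => i _.
  by rewrite -scalemxAr mul_rV_lin1 -scalerAl linearZ.
have nz_w : w != 0.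
  apply: contraNneq nz_u => w0; apply/eqP/colP=> i; rewrite !mxE.
  have : F w = 0 by rewrite w0 linear0.
  rewrite linear_sum => /rowP/(_ (widen_ord mN i)).
  rewrite summxE (bigD1 i) //= big1 ?addr0 => [|j ji]; last first.
    rewrite [f _](linearZZ F) /= gK !mxE (inj_eq widen_inj) eq_sym (negbTE ji).
    by rewrite andbF mulr0.
  by rewrite [f _](linearZZ F) /= gK !mxE !eqxx mulr1.
rewrite -row_free_unit -kermx_eq0; apply/rowV0P=> x /sub_kermxP; rewrite wE.
rewrite -[0 in RHS](linear0 F) => /(can_inj fK)/eqP.
rewrite mulf_eq0 (negbTE nz_w) => /eqP/= gx.
by rewrite -[x]gK gx; apply: (linear0 F).
Qed.

(** * Right invertible matrices and subspaces *)


Section RightInvertible.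

Variable R : finComUnitRingType.
Implicit Types k l n : nat.

Lemma right_invertibleP k n (A : 'M[R]_(k, n)) :
  reflect (exists B : 'M_(n, k), A *m B = 1%:M) (right_invertible A).
Proof. by apply: (iffP existsP) => -[B /eqP AB]; exists B. Qed.

Lemma right_invertible_mull k l n (A : 'M[R]_(k, l)) (B : 'M_(l, n)) :
  right_invertible (A *m B) -> right_invertible A.
Proof.
by move=> /right_invertibleP[C ABC]; apply/right_invertibleP;
  exists (B *m C); rewrite mulmxA.
Qed.

Lemma right_invertibleM k l n (A : 'M[R]_(k, l)) (B : 'M_(l, n)) :
  right_invertible A -> right_invertible B -> right_invertible (A *m B).
Proof.
move=> /right_invertibleP[A' AA'] /right_invertibleP[B' BB'].
by apply/right_invertibleP; exists (B' *m A');
  rewrite -mulmxA (mulmxA B) BB' mul1mx.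
Qed.

Lemma right_invertible_unit k (A : 'M[R]_k) :
  right_invertible A = (A \in unitmx).
Proof.
apply/right_invertibleP/idP => [[B /mulmx1_unit[]]//|uA].
by exists (invmx A); rewrite mulmxV.
Qed.

Lemma right_invertible_inj k l n (A : 'M[R]_(k, n)) :
  right_invertible A -> injective (fun X : 'M_(l, k) => X *m A).
Proof.
move=> /right_invertibleP[B AB] X Y /(congr1 (mulmx^~ B)).
by rewrite -!mulmxA AB !mulmx1.
Qed.

Lemma rowsub_right_invertible k l n (f : 'I_k -> 'I_l) (A : 'M[R]_(l, n)) :
  injective f -> right_invertible A -> right_invertible (rowsub f A).
Proof.
move=> f_inj /right_invertibleP[B AB]; apply/right_invertibleP.
exists (colsub f B); apply/matrixP=> i j.
rewrite mxE (eq_bigr (fun h => A (f i) h * B h (f j))); last first.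
  by move=> h _; rewrite !mxE.
by move/matrixP/(_ (f i) (f j)): AB; rewrite !mxE (inj_eq f_inj).
Qed.

Lemma right_invertible_row_inj k n (A : 'M[R]_(k, n)) :
  right_invertible A -> injective (fun i => row i A).
Proof.
move=> rA i j; rewrite !rowE => /(right_invertible_inj rA)/matrixP/(_ 0 i).
by rewrite !mxE !eqxx /=; case: eqP => // _ /eqP; rewrite oner_eq0.
Qed.

Lemma mem_row_span k n (A : 'M[R]_(k, n)) x : x *m A \in row_span A.
Proof. exact: imset_f. Qed.

Lemma row_mem_row_span k n (A : 'M[R]_(k, n)) i : row i A \in row_span A.
Proof. by rewrite rowE mem_row_span. Qed.

Lemma rows_row_span k l n (A : 'M[R]_(k, n)) (B : 'M_(l, n)) :
  (forall i, row i A \in row_span B) -> exists D : 'M_(k, l), A = D *m B.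
Proof.
move=> AB; have h i : exists x : 'rV_l, row i A == x *m B.
  by case/imsetP: (AB i) => y _ ->; exists y.
exists (\matrix_i xchoose (h i)); apply/row_matrixP=> i.
by rewrite row_mul rowK; apply/eqP/(xchooseP (h i)).
Qed.

Lemma row_span_sub k l n (A : 'M[R]_(k, n)) (B : 'M_(l, n)) :
  reflect (exists D : 'M_(k, l), A = D *m B) (row_span A \subset row_span B).
Proof.
apply: (iffP subsetP) => [AB|[D ->] _ /imsetP[x _ ->]]; last first.
  by rewrite mulmxA mem_row_span.
by apply: rows_row_span => i; rewrite AB ?row_mem_row_span.
Qed.

Lemma row_span_submodule k n (A : 'M[R]_(k, n)) : submodule (row_span A).
Proof.
apply/andP; split; first by rewrite -(mul0mx _ A) mem_row_span.
apply/forallP=> a; apply/forall_inP=> _ /imsetP[x _ ->].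
apply/forall_inP=> _ /imsetP[y _ ->].
by rewrite scalemxAl -mulmxDl mem_row_span.
Qed.

Lemma submoduleI n (V W : {set 'rV[R]_n}) :
  submodule V -> submodule W -> submodule (V :&: W).
Proof.
move=> /andP[V0 /forallP VS] /andP[W0 /forallP WS].
rewrite /submodule inE V0 W0; apply/forallP=> a.
apply/forall_inP=> u /setIP[uV uW]; apply/forall_inP=> v /setIP[vV vW].
by rewrite inE (forall_inP (forall_inP (VS a) u uV)) //
  (forall_inP (forall_inP (WS a) u uW)).
Qed.

(** A right inverse already makes the rows linearly independent, and a row span is always a
    submodule. *)
Lemma subspaceP k n (V : {set 'rV[R]_n}) :
  reflect (exists2 A : 'M_(k, n), right_invertible A & V = row_span A)
          (subspace k V).
Proof.
apply: (iffP andP) => [[_ /existsP[A /andP[/andP[/eqP <- _] rA]]]|[A rA ->]].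
  by exists A.
split; first exact: row_span_submodule.
apply/existsP; exists A; rewrite /represents rA /basis_rows eqxx /= andbT.
apply/forallP=> x; apply/implyP=> /eqP xA.
by apply/eqP/(right_invertible_inj rA); rewrite xA mul0mx.
Qed.

Lemma matrix_repP k n (V : {set 'rV[R]_n}) : subspace k V ->
  right_invertible (matrix_rep k V) /\ row_span (matrix_rep k V) = V.
Proof.
case/andP=> _ /existsP[A rA]; rewrite /matrix_rep; case: pickP => [B|/(_ A)].
  by case/andP=> /andP[/eqP].
by rewrite rA.
Qed.

(** Trades sets of vectors for matrices. Rows of a right invertible matrix are distinct, and any
    selection of them stays right invertible, so a larger unimodular set can be cut down to [k]
    rows. *)
Lemma leq_unimod_dimP k n (V : {set 'rV[R]_n}) :
  reflect (exists2 A : 'M_(k, n), right_invertible A & forall i, row i A \in V)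
          (k <= unimod_dim V)%N.
Proof.
apply: (iffP idP) => [|[A rA AV]]; last first.
  pose S := [set row i A | i : 'I_k].
  have cS : #|S| = k.
    by rewrite card_imset ?card_ord //; apply: right_invertible_row_inj.
  rewrite -[X in (X <= _)%N]cS; apply: (bigmax_sup S) => //; apply/andP; split.
    by apply/subsetP=> _ /imsetP[i _ ->].
  have mS (i : 'I_#|S|) : exists j : 'I_k, enum_val i == row j A.
    by case/imsetP: (enum_valP i) => j _ ->; exists j.
  (* Enumerating [S] may permute the rows of [A]; [f] records how. *)
  pose f i := xchoose (mS i).
  have fE i : enum_val i = row (f i) A by apply/eqP/(xchooseP (mS i)).
  have f_inj : injective f.
    by move=> i j fij; apply: enum_val_inj; rewrite !fE fij.
  rewrite /unimodular (_ : \matrix_i _ = rowsub f A).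
    exact: rowsub_right_invertible.
  by apply/row_matrixP=> i; rewrite rowK row_rowsub fE.
(* The maximum is attained because its range is nonempty: the matrix of the empty set has no
   rows. *)
have [S [SV uS] ->] : exists2 S : {set 'rV[R]_n},
    S \subset V /\ unimodular S & unimod_dim V = #|S|.
  pose Q (S : {set 'rV[R]_n}) := (S \subset V) && unimodular S.
  have h0 : Q set0.
     rewrite /Q sub0set /=; apply/right_invertibleP; exists 0.
    by apply/matrixP=> i; case: (i) => a ha; exfalso; rewrite cards0 in ha.
  rewrite /unimod_dim (bigmax_eq_arg (P := Q) _ h0).
  by case: arg_maxnP => // S /andP[? ?] _; exists S.
move=> kS; exists (rowsub (widen_ord kS) (\matrix_(i < #|S|) enum_val i)).
  by apply: rowsub_right_invertible => // i j /(congr1 val)/= /val_inj.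
by move=> i; rewrite row_rowsub rowK (subsetP SV) ?enum_valP.
Qed.

(** The square matrix [D] with [A = D *m B] inherits a right inverse from [A], hence is a unit. *)
Lemma row_span_eq m n (A B : 'M[R]_(m, n)) :
  right_invertible A -> row_span A \subset row_span B ->
  row_span A = row_span B.
Proof.
move=> rA /[dup] AB /row_span_sub[D AE]; apply/eqP; rewrite eqEsubset AB /=.
apply/row_span_sub; exists (invmx D); rewrite AE mulKmx //.
rewrite -right_invertible_unit.
by apply: right_invertible_mull (B) _; rewrite -AE.
Qed.

(** The dimension cannot exceed [m - 1] for distinct vertices: [m] unimodular rows in the
    intersection would span both [V] and [W]. *)
Lemma grass_adjP m n (V W : {set 'rV[R]_n}) : (0 < m)%N ->
  subspace m V -> subspace m W -> V != W ->
  reflect (exists2 C : 'M_(m - 1, n), right_invertible C &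
             row_span C \subset V /\ row_span C \subset W)
          (grass_adj m V W).
Proof.
move=> m_gt0 sV sW VW; have [rA /esym VE] := matrix_repP sV.
have [rB /esym WE] := matrix_repP sW; move: (matrix_rep _ _) rA VE => A rA VE.
move: (matrix_rep _ _) rB WE => B rB WE.
have rows k (C : 'M[R]_(k, n)) : (forall i, row i C \in V :&: W) <->
    row_span C \subset V /\ row_span C \subset W.
  rewrite VE WE; split=> [h|[/subsetP CV /subsetP CW] i]; last first.
    by rewrite inE CV ?CW ?row_mem_row_span.
  by split; apply/row_span_sub/rows_row_span => i; have /setIP[] := h i.
apply: (iffP andP) => [[_ /eqP dVW]|[C rC CVW]].
  have : (m - 1 <= unimod_dim (V :&: W))%N by rewrite dVW.
  by case/leq_unimod_dimP=> C rC /rows; exists C.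
split; first by rewrite VE WE submoduleI ?row_span_submodule.
rewrite eqn_leq andbC; apply/andP; split.
  by apply/leq_unimod_dimP; exists C => //; apply/rows.
rewrite leqNgt subn1 prednK //; apply/negP=> /leq_unimod_dimP[D rD /rows[DV DW]].
case/eqP: VW; rewrite VE WE -(row_span_eq rD) -?VE //.
by rewrite (row_span_eq rD (B := B)) -?WE.
Qed.

End RightInvertible.

(** * Local rings and the fibres of reduction *)


(** Each fibre is a translate of the kernel. *)
Lemma card_preimset_additive (U V : finZmodType) (f : {additive U -> V})
    (S : {set V}) :
  (forall y, exists x, f x = y) ->
  #|f @^-1: S| = (#|S| * #|f @^-1: [set 0%R]|)%N.
Proof.
move=> f_surj; rewrite -sum1_card (partition_big f (mem S)) /=; last first.
  by move=> x; rewrite inE.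
rewrite -sum_nat_const; apply: eq_bigr => y Sy; have [x0 fx0] := f_surj y.
rewrite (reindex_inj (addrI x0)) /= sum1_card; apply: eq_card => x.
rewrite unfold_in /= !inE raddfD fx0.
by rewrite -{3}[y]addr0 (inj_eq (addrI y)) andb_idl // => /eqP ->; rewrite addr0.
Qed.

Lemma right_invertible_row_free (F : finFieldType) k n (A : 'M[F]_(k, n)) :
  right_invertible A = row_free A.
Proof. by apply/right_invertibleP/row_freeP. Qed.

Section LocalRing.

Variables (R : finComUnitRingType) (F : finFieldType) (pi : {rmorphism R -> F}).
Hypothesis pi_surj : forall y, exists x, pi x = y.
Hypothesis pi_unit : forall x, pi x != 0 -> x \is a GRing.unit.

Lemma map_mx_surj k n (B : 'M[F]_(k, n)) :
  exists A : 'M[R]_(k, n), map_mx pi A = B.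
Proof.
have pi_surjb y : exists x, pi x == y by have [x <-] := pi_surj y; exists x.
exists (map_mx (fun y => xchoose (pi_surjb y)) B).
by apply/matrixP=> i j; rewrite !mxE; apply/eqP/(xchooseP (pi_surjb _)).
Qed.

Lemma unitmx_pi k (A : 'M[R]_k) : (map_mx pi A \in unitmx) = (A \in unitmx).
Proof.
rewrite !unitmxE det_map_mx unitfE; apply/idP/idP; first exact: pi_unit.
by move/(rmorph_unit pi); rewrite unitfE.
Qed.

(** A lifted right inverse is correct up to a square matrix reducing to the identity, hence up to a
    unit. *)
Lemma right_invertible_pi k n (A : 'M[R]_(k, n)) :
  right_invertible (map_mx pi A) = right_invertible A.
Proof.
apply/right_invertibleP/right_invertibleP=> -[B AB]; last first.
  by exists (map_mx pi B); rewrite -map_mxM AB map_mx1.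
have [B' B'E] := map_mx_surj B.
have uAB : A *m B' \in unitmx by rewrite -unitmx_pi map_mxM B'E AB unitmx1.
by exists (B' *m invmx (A *m B')); rewrite mulmxA mulmxV.
Qed.

Lemma card_pi_preim k (S : {set 'rV[F]_k}) :
  #|[set x : 'rV[R]_k | map_mx pi x \in S]| =
    (#|S| * #|[set x | pi x == 0%R]| ^ k)%N.
Proof.
have piE (U : {set F}) : #|pi @^-1: U| = (#|U| * #|[set x | pi x == 0%R]|)%N.
  rewrite card_preimset_additive //; congr (_ * _)%N.
  by apply: eq_card => x; rewrite !inE.
have pikE (U : {set 'rV[F]_k}) : #|map_mx pi @^-1: U| =
    (#|U| * #|map_mx pi @^-1: [set (0%R : 'rV_k)]|)%N.
  by apply: card_preimset_additive; apply: map_mx_surj.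
(* With the full target, [#|R| ^ k] is computed in two ways; cancelling [#|F| ^ k] gives the size of
   the kernel on rows. *)
have := pikE setT; rewrite preimsetT !cardsT !card_mx mul1n.
have := piE setT; rewrite preimsetT !cardsT => ->.
rewrite expnMn => /eqP; rewrite eqn_pmul2l; last first.
  by rewrite expn_gt0; apply/orP; left; apply/card_gt0P; exists 0.
by move=> /eqP ->; rewrite -pikE.
Qed.

Lemma card_pi : #|R| = (#|F| * #|[set x | pi x == 0%R]|)%N.
Proof.
have := card_preimset_additive (f := pi) setT pi_surj.
rewrite preimsetT !cardsT => ->; congr (_ * _)%N.
by apply: eq_card => x; rewrite !inE.
Qed.

Lemma pi_row_span k n (A : 'M[R]_(k, n)) :
  [set map_mx pi x | x in row_span A] = row_span (map_mx pi A).
Proof.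
apply/setP=> y; apply/imsetP/imsetP=> [[_ /imsetP[x _ ->] ->]|[z _ ->]].
  by exists (map_mx pi x); rewrite // map_mxM.
have [x <-] := map_mx_surj z.
by exists (x *m A); rewrite ?mem_row_span // map_mxM.
Qed.

(** Over [F], Gaussian elimination supplies the missing rows as the lower part of [row_ebase]. Any
    lift of them works, because units are detected after reduction. *)
Lemma right_invertible_complete k l (A : 'M[R]_(k, k + l)) :
  right_invertible A -> exists A' : 'M_(l, k + l), col_mx A A' \in unitmx.
Proof.
rewrite -right_invertible_pi right_invertible_row_free => /eqP rA.
have [A' A'E] := map_mx_surj (dsubmx (row_ebase (map_mx pi A))).
exists A'; rewrite -unitmx_pi map_col_mx A'E -{1}(mulmx_ebase (map_mx pi A)) rA.
rewrite (pid_mx_row _ l k) mul_mx_row mulmx1 mulmx0.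
rewrite -{1}[row_ebase _]vsubmxK mul_row_col mul0mx addr0.
(* The completed matrix becomes a block diagonal matrix, with blocks [col_ebase] and [1], times
   [row_ebase]. *)
rewrite -[dsubmx _]mul1mx -(addr0 (_ *m usubmx _)) -(add0r (1%:M *m _)).
rewrite -[X in _ + X](mul0mx _ (dsubmx (row_ebase (map_mx pi A)))).
rewrite -[X in X + 1%:M *m _](mul0mx _ (usubmx (row_ebase (map_mx pi A)))).
rewrite -mul_block_col vsubmxK unitmx_mul row_ebase_unit andbT.
by rewrite unitmxE det_ublock det1 mulr1 -unitmxE col_ebase_unit.
Qed.

(** Complete [Y] by one row [y] to an invertible [Z]. All rows of [Z *m D] but the last, [y *m D],
    vanish, so [u] can be the last column of the inverse; [y *m u = 1] keeps it nonzero after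
    reduction. *)
Lemma kernel_rank_one k m N (Y : 'M[R]_(k, m)) (D : 'M_(m, N)) :
  m = (k + 1)%N -> right_invertible Y -> Y *m D = 0 ->
  exists u : 'cV_m, exists2 z : 'rV_N, map_mx pi u != 0 & D = u *m z.
Proof.
move=> mE; subst m; move=> /right_invertible_complete[y uZ] YD.
set Z := col_mx Y y in uZ; exists (rsubmx (invmx Z)), (y *m D); last first.
  rewrite -[LHS](mulKmx uZ) mul_col_mx YD -{1}[invmx Z]hsubmxK.
  by rewrite mul_row_col mulmx0 add0r.
apply/eqP=> pu0; have := mulmxV uZ; rewrite -[X in _ *m X]hsubmxK mul_col_row.
rewrite scalar_mx_block => /eq_block_mx[_ _ _ /(congr1 (map_mx pi))].
rewrite map_mxM pu0 mulmx0 map_mx1 => /matrixP/(_ 0 0).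
by rewrite !mxE => /esym/eqP; rewrite oner_eq0.
Qed.

(* If [V] and [W] have the same reduction, then in suitable coordinates they are
   the row spaces of [1 | X] and [1 | Y], with [X] and [Y] zero modulo the
   maximal ideal. They are adjacent when [X - Y = u *m z] with [u] a unimodular
   column, so the additive map [X |-> \sum_i row i X *m T i] separates them. *)
Lemma card_clique_fiber m N (T : 'I_m -> 'M[F]_N)
    (M : {set {set 'rV[R]_(m + N)}}) (U : {set 'rV[F]_(m + N)}) :
  (0 < m)%N ->
  (forall u : 'cV_m, u != 0 -> \sum_i u i 0 *: T i \in unitmx) ->
  clique (grass_vertices R (m + N) m) (grass_adj m) M ->
  (forall V, V \in M -> [set map_mx pi x | x in V] = U) ->
  (#|M| <= #|[set x | pi x == 0%R]| ^ N)%N.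
Proof.
move=> m_gt0 T_unit /andP[/subsetP Msub /forall_inP Madj] MU.
have sM V : V \in M -> subspace m V by move/Msub; rewrite inE.
have [->|[V0 V0M]] := set_0Vmem M; first by rewrite cards0.
have [rA0 A0E] := matrix_repP (sM _ V0M).
move: (matrix_rep _ _) rA0 A0E => A0 rA0 A0E.
have [A' uE] := right_invertible_complete rA0; set E := col_mx A0 A' in uE.
pose repr V X := (map_mx pi X == 0) && (V == row_span (row_mx 1%:M X *m E)).
have rX (X : 'M_(m, N)) : right_invertible (row_mx 1%:M X *m E).
  apply: right_invertibleM; last by rewrite right_invertible_unit.
  apply/right_invertibleP; exists (col_mx 1%:M 0).
  by rewrite mul_row_col mulmx1 mulmx0 addr0.
have ex_repr V : V \in M -> exists X, repr V X.
  move=> VM; have [rA AE] := matrix_repP (sM _ VM).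
  move: (matrix_rep _ _) rA AE => A rA AE.
  have [D AD] : exists D, map_mx pi A = D *m map_mx pi A0.
    by apply/row_span_sub; rewrite -!pi_row_span AE A0E !MU.
  have uD : D \in unitmx.
    rewrite -right_invertible_unit.
    apply: (right_invertible_mull (B := map_mx pi A0)).
    by rewrite -AD right_invertible_pi.
  (* In the coordinates given by [E], [A0] is [[1 | 0]], so [A] reduces to [[D | 0]]. Its left block
     is thus a unit over [R], and dividing by it yields [[1 | X]] with [X] reducing to zero. *)
  have A0G : A0 *m invmx E = row_mx 1%:M 0.
    rewrite -[RHS](mulmxK uE); congr (_ *m _).
    by rewrite mul_row_col mul1mx mul0mx addr0.
  have /eq_row_mx[lE rE] : row_mx (map_mx pi (lsubmx (A *m invmx E)))
      (map_mx pi (rsubmx (A *m invmx E))) = row_mx D 0.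
    rewrite -map_row_mx hsubmxK map_mxM AD -mulmxA -map_mxM A0G map_row_mx.
    by rewrite map_mx1 map_mx0 mul_mx_row mulmx1 mulmx0.
  set B := A *m invmx E in lE rE.
  have uB : lsubmx B \in unitmx by rewrite -unitmx_pi lE.
  exists (invmx (lsubmx B) *m rsubmx B); apply/andP; split.
    by rewrite map_mxM rE mulmx0.
  rewrite -AE eq_sym; apply/eqP/row_span_eq => //; apply/row_span_sub.
  exists (invmx (lsubmx B)); rewrite -[X in row_mx X](mulVmx uB) -mul_mx_row.
  by rewrite hsubmxK -mulmxA mulmxKV.
pose X V := odflt 0 [pick X | repr V X].
have XP V : V \in M -> repr V (X V).
  by move=> /ex_repr[Y VY]; rewrite /X; case: pickP => [//|/(_ Y)]; rewrite VY.
have [T' T'E] : exists T' : 'I_m -> 'M[R]_N, forall i, map_mx pi (T' i) = T i.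
  have h i : exists A : 'M[R]_N, map_mx pi A == T i.
    by have [A <-] := map_mx_surj (T i); exists A.
  by exists (fun i => xchoose (h i)) => i; apply/eqP/(xchooseP (h i)).
pose phi V := \sum_i row i (X V) *m T' i.
have phi_inj : {in M &, injective phi}.
  move=> V W VM WM phiVW; apply/eqP; apply/negPn/negP => neqVW.
  have /andP[pX0 /eqP VE] := XP V VM; have /andP[pY0 /eqP WE] := XP W WM.
  move/implyP: (forall_inP (Madj V VM) W WM) => /(_ neqVW).
  case/(grass_adjP m_gt0 (sM _ VM) (sM _ WM) neqVW) => C rC [].
  rewrite {1}VE {1}WE => /row_span_sub[Y1 CY1] /row_span_sub[Y2 CY2].
  have rY1 : right_invertible Y1.
    by rewrite CY1 in rC; apply: right_invertible_mull rC.
  (* Comparing left blocks gives [Y1 = Y2], so the [m - 1] unimodular rows of [Y1] kill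
     [X V - X W]. *)
  have : Y1 *m row_mx 1%:M (X V) = Y2 *m row_mx 1%:M (X W).
    apply: (right_invertible_inj (A := E)); rewrite ?right_invertible_unit //.
    by rewrite /= -!mulmxA -CY1.
  rewrite !mul_mx_row !mulmx1 => /eq_row_mx[<- /eqP].
  rewrite -subr_eq0 -mulmxBr => /eqP YD.
  have mE : m = (m - 1 + 1)%N by rewrite subnK.
  have [u [z pu DE]] := kernel_rank_one mE rY1 YD.
  (* [phi] is additive in [X], so on [u *m z] it gives [z] times a matrix that is a unit because its
     reduction is; hence [z = 0]. *)
  have Dphi : z *m (\sum_i u i 0 *: T' i) = 0.
    transitivity (phi V - phi W); last by rewrite phiVW subrr.
    rewrite /phi -sumrB mulmx_sumr; apply: eq_bigr => i _.
    rewrite -mulmxBl -raddfB /= DE row_mul -scalemxAr scalemxAl; congr (_ *m _).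
    by apply/rowP=> j; rewrite !mxE big_ord1 !mxE.
  have uS : \sum_i u i 0 *: T' i \in unitmx.
    rewrite -unitmx_pi raddf_sum /=.
    rewrite (eq_bigr (fun i => map_mx pi u i 0 *: T i)) ?T_unit // => i _.
    by rewrite map_mxZ T'E mxE.
  have z0 : z = 0 by rewrite -(mulmxK uS z) Dphi mul0mx.
  case/eqP: neqVW; rewrite VE WE; congr (row_span (row_mx _ _ *m _)).
  by apply/eqP; rewrite -subr_eq0 DE z0 mulmx0.
rewrite -(card_in_imset phi_inj).
(* The values of [phi] reduce to zero because the matrices [X V] do. *)
have -> : (#|[set x | pi x == 0%R]| ^ N)%N =
    #|[set x : 'rV[R]_N | map_mx pi x \in [set 0]]|.
  by rewrite card_pi_preim cards1 mul1n.
apply/subset_leq_card/subsetP=> _ /imsetP[V VM ->]; rewrite !inE.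
rewrite /phi raddf_sum big1 // => i _; rewrite /= map_mxM map_row.
by have /andP[/eqP -> _] := XP V VM; rewrite row0 mul0mx.
Qed.

End LocalRing.

(** * Cliques over a finite field *)


(** Double counting of pairs [(a, x)] with [x] in [f a] but not in the core [P]: each such [x] lies
    in at most one [f a]. *)
Lemma card_sunflower_le (T X : finType) (K : {set T}) (f : T -> {set X})
    (P : {set X}) c :
  {in K, forall a, P \subset f a} -> {in K, forall a, #|f a| = c} ->
  {in K &, forall a b, a != b -> f a :&: f b \subset P} ->
  (#|K| * (c - #|P|) <= #|X| - #|P|)%N.
Proof.
move=> Pf cf fP.
have -> : (#|K| * (c - #|P|) =
           \sum_(a in K) \sum_(x | x \notin P) (x \in f a))%N.
  rewrite -sum_nat_const; apply: eq_bigr => a aK.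
  rewrite -(cf a aK) -(cardsDS (Pf a aK)) -sum1_card big_mkcond [RHS]big_mkcond.
  by apply: eq_bigr => x _; rewrite inE; case: (x \notin P); case: (x \in f a).
rewrite exchange_big /= -(cardC P) addKn -sum1_card.
apply: leq_sum => x xP.
have [/exists_inP[a aK xa]|/exists_inPn xK] := boolP [exists a in K, x \in f a].
  rewrite (bigD1 a) //= xa big1 // => b /andP[bK ba].
  apply/eqP; rewrite eqb0; apply: contra xP => xb.
  by apply: (subsetP (fP b a bK aK ba)); rewrite inE xb xa.
by rewrite big1 // => a /xK/negbTE->.
Qed.

Section FiniteField.

Variable F : finFieldType.
Implicit Types k l m n : nat.

Lemma mem_row_spanE k n (A : 'M[F]_(k, n)) x :
  (x \in row_span A) = (x <= A)%MS.
Proof. by apply/imsetP/submxP=> [[y _ ->]|[y ->]]; exists y. Qed.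

Lemma row_span_subE k l n (A : 'M[F]_(k, n)) (B : 'M_(l, n)) :
  (row_span A \subset row_span B) = (A <= B)%MS.
Proof. by apply/row_span_sub/submxP. Qed.

Lemma row_span_subspace k n (A : 'M[F]_(k, n)) : subspace (\rank A) (row_span A).
Proof.
apply/subspaceP; exists (row_base A).
  by rewrite right_invertible_row_free row_base_free.
by apply/eqP; rewrite eqEsubset !row_span_subE !eq_row_base submx_refl.
Qed.

Lemma matrix_rep_fieldP k n (V : {set 'rV[F]_n}) : subspace k V ->
  \rank (matrix_rep k V) = k /\ row_span (matrix_rep k V) = V.
Proof.
by move/matrix_repP=> []; rewrite right_invertible_row_free => /eqP.
Qed.

Lemma card_subspace k n (V : {set 'rV[F]_n}) : subspace k V ->
  #|V| = (#|F| ^ k)%N.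
Proof.
case/subspaceP=> A rA ->; rewrite card_imset ?card_mx ?mul1n //.
exact: right_invertible_inj.
Qed.

Lemma capmx_rank_lt m n (A B : 'M[F]_(m, n)) : \rank A = m -> \rank B = m ->
  row_span A != row_span B -> (\rank (A :&: B) < m)%N.
Proof.
move=> rA rB; apply: contraNT; rewrite -leqNgt => rAB.
have AB : (A <= A :&: B)%MS.
  rewrite -(mxrank_leqif_sup (capmxSl A B)) eqn_leq mxrankS ?capmxSl //=.
  by rewrite rA.
have BA : (B <= A :&: B)%MS.
  rewrite -(mxrank_leqif_sup (capmxSr A B)) eqn_leq mxrankS ?capmxSr //=.
  by rewrite rB.
by rewrite eqEsubset !row_span_subE (submx_trans AB (capmxSr _ _))
  (submx_trans BA (capmxSl _ _)).
Qed.

Lemma grass_adj_rank m n (V W : {set 'rV[F]_n}) : (0 < m)%N ->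
  subspace m V -> subspace m W -> V != W -> grass_adj m V W ->
  \rank (matrix_rep m V :&: matrix_rep m W)%MS = (m - 1)%N.
Proof.
move=> m_gt0 sV sW VW adjVW.
have [rA AV] := matrix_rep_fieldP sV; have [rB BW] := matrix_rep_fieldP sW.
apply/eqP; rewrite eqn_leq -ltnS subn1 prednK // capmx_rank_lt ?AV ?BW //=.
case/(grass_adjP m_gt0 sV sW VW): adjVW => C.
rewrite right_invertible_row_free => /eqP rC [].
move: (matrix_rep m V) (matrix_rep m W) rA AV rB BW => A B rA AV rB BW.
rewrite -AV -BW !row_span_subE => CA CB.
by rewrite -[X in (X <= _)%N]subn1 -[X in (X <= _)%N]rC mxrankS // sub_capmx CA.
Qed.

(** If [C] meets [A] and [B] in the same space, ranks force it to be [A :&: B]. Otherwise the two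
    intersections together have rank [m], so they generate [C] inside [A + B]. *)
Lemma capmx_sub_or_sub_addsmx m n (A B C : 'M[F]_(m, n)) :
  \rank C = m -> \rank (A :&: B)%MS = (m - 1)%N ->
  \rank (C :&: A)%MS = (m - 1)%N -> \rank (C :&: B)%MS = (m - 1)%N ->
  (A :&: B <= C)%MS || (C <= A + B)%MS.
Proof.
move=> rC rAB rCA rCB; have [sub|nsub] := boolP (C :&: B <= C :&: A)%MS.
  have sub' : (C :&: B <= A :&: B)%MS.
    by rewrite sub_capmx (submx_trans sub (capmxSr _ _)) capmxSr.
  have : (A :&: B <= C :&: B)%MS by rewrite -(mxrank_leqif_sup sub') rCB rAB.
  by move/submx_trans->; rewrite ?capmxSl.
apply/orP; right.
set D := (C :&: A + C :&: B)%MS.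
have DC : (D <= C)%MS by rewrite addsmx_sub !capmxSl.
have DAB : (D <= A + B)%MS by apply: addsmxS; apply: capmxSr.
apply: submx_trans DAB.
rewrite -(mxrank_leqif_sup DC) eqn_leq mxrankS //= rC.
have : (\rank (C :&: A) < \rank D)%N.
  rewrite (ltn_leqif (mxrank_leqif_sup (addsmxSl _ _))).
  by apply: contra nsub; apply: submx_trans; apply: addsmxSr.
by rewrite rCA; case: (m) => // k; rewrite subn1.
Qed.

(** Two distinct members [V], [W] fix candidates [P] (intersection) and [Q] (sum), and each member
    contains [P] or lies in [Q]. What remains is to make the same alternative hold for all members
    at once. *)
Lemma clique_sub_star_or_top m n (K : {set {set 'rV[F]_n}}) : (0 < m)%N ->
  clique (grass_vertices F n m) (grass_adj m) K -> K != set0 ->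
  (exists2 P, subspace (m - 1) P & {in K, forall V : {set _}, P \subset V}) \/
  (exists2 Q, subspace (m + 1) Q & {in K, forall V : {set _}, V \subset Q}).
Proof.
move=> m_gt0 /andP[/subsetP sK /forall_inP adjK] /set0Pn[V VK].
have {}sK W : W \in K -> subspace m W by move/sK; rewrite inE.
pose A (W : {set 'rV[F]_n}) := matrix_rep m W.
have rA W : W \in K -> \rank (A W) = m by move/sK/matrix_rep_fieldP=> [].
have AE W : W \in K -> row_span (A W) = W by move/sK/matrix_rep_fieldP=> [].
have capK W1 W2 : W1 \in K -> W2 \in K -> W1 != W2 ->
    \rank (A W1 :&: A W2)%MS = (m - 1)%N.
  move=> K1 K2 W12; apply: grass_adj_rank (sK _ _) (sK _ _) _ _ => //.
  by move/implyP: (forall_inP (adjK _ K1) _ K2); apply.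
have [/existsP[W /andP[WK VW]]|] := boolP [exists W, (W \in K) && (V != W)];
  last first.
  (* For a one-element clique, the first [m - 1] rows of a basis of [V] span a suitable [P]. *)
  move/existsPn=> Kuniq; left; have [rV _] := matrix_repP (sK _ VK).
  have mE : (m - 1 <= m)%N by rewrite leq_subr.
  exists (row_span (rowsub (widen_ord mE) (A V))).
    apply/subspaceP; exists (rowsub (widen_ord mE) (A V)) => //.
    by apply: rowsub_right_invertible => // i j /(congr1 val)/= /val_inj.
  move=> W WK; have := Kuniq W; rewrite WK /= negbK => /eqP <-.
  rewrite -[V in X in _ \subset X]AE // row_span_subE; apply/row_subP=> i.
  by rewrite row_rowsub row_sub.
set P := (A V :&: A W)%MS; set Q := (A V + A W)%MS.
have rP : \rank P = (m - 1)%N by apply: capK.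
have rQ : \rank Q = (m + 1)%N.
  have := mxrank_sum_cap (A V) (A W); rewrite -/P -/Q rP !rA //.
  by move: m_gt0; case: (m) => // k _; rewrite subn1 /= !addnS => -[/eqP];
     rewrite -addSn eqn_add2r => /eqP ->; rewrite addn0.
have PQ C : C \in K -> (P <= A C)%MS || (A C <= Q)%MS.
  move=> CK; have [->|CV] := eqVneq C V; first by rewrite capmxSl.
  have [->|CW] := eqVneq C W; first by rewrite capmxSr.
  by apply: capmx_sub_or_sub_addsmx; rewrite ?rA ?capK.
have [/forall_inP PK|/forall_inPn[C0 C0K PC0]] :=
    boolP [forall C in K, (P <= A C)%MS].
  left; exists (row_span P); first by rewrite -rP row_span_subspace.
  by move=> C CK; rewrite -(AE _ CK) row_span_subE PK.
right; exists (row_span Q); first by rewrite -rQ row_span_subspace.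
move=> C CK; rewrite -(AE _ CK) row_span_subE; apply: contraNT PC0 => CQ.
have PC : (P <= A C)%MS by have := PQ C CK; rewrite (negbTE CQ) orbF.
(* A member [C] outside [Q] meets [Q] only in [P]. As [C0] lies in [Q], it meets [C] inside [P], and
   by rank exactly in [P], so [C0] would contain [P]. *)
have CQP : (A C :&: Q <= P)%MS.
  have sub : (P <= A C :&: Q)%MS.
    by rewrite sub_capmx PC (submx_trans (capmxSl _ _) (addsmxSl _ _)).
  rewrite -(mxrank_leqif_sup sub) eqn_leq mxrankS //= rP.
  have : (\rank (A C :&: Q) < \rank (A C))%N.
    rewrite (ltn_leqif (mxrank_leqif_sup (capmxSl _ _))).
    by apply: contra CQ => /submx_trans; apply; apply: capmxSr.
  by rewrite rA // -[X in (_ < X)%N -> _](prednK m_gt0) subn1.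
have [->//|C0C] := eqVneq C0 C.
have [//|C0Q] := orP (PQ C0 C0K).
have sub : (A C0 :&: A C <= P)%MS.
  apply: submx_trans CQP; rewrite sub_capmx capmxSr.
  exact: submx_trans (capmxSl _ _) C0Q.
have : (P <= A C0 :&: A C)%MS by rewrite -(mxrank_leqif_sup sub) rP capK.
by move/submx_trans; apply; apply: capmxSl.
Qed.

(** Distinct members share at most [m - 1] dimensions, so outside [P] they are disjoint and the
    sunflower bound applies. *)
Lemma card_star_le m n (P : {set 'rV[F]_n}) (K : {set {set 'rV[F]_n}}) :
  (0 < m)%N -> subspace (m - 1) P ->
  {in K, forall V : {set 'rV_n}, subspace m V && (P \subset V)} ->
  (#|K| * (#|F| ^ m - #|F| ^ (m - 1)) <= #|F| ^ n - #|F| ^ (m - 1))%N.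
Proof.
move=> m_gt0 sP KP; rewrite -(card_subspace sP).
have -> : (#|F| ^ n)%N = #|{: 'rV[F]_n}| by rewrite card_mx mul1n.
apply: (card_sunflower_le (f := id)) => [V /KP/andP[]//|V|V W].
  by case/KP/andP=> sV _; rewrite (card_subspace sV).
move=> /KP/andP[sV PV] /KP/andP[sW PW] VW.
have [rA AV] := matrix_rep_fieldP sV; have [rB BW] := matrix_rep_fieldP sW.
have [rC CP] := matrix_rep_fieldP sP.
move: (matrix_rep m V) (matrix_rep m W) (matrix_rep _ P) rA AV rB BW rC CP.
move=> A B C rA AV rB BW rC CP.
move: PV PW; rewrite -CP -AV -BW !row_span_subE => CA CB.
have sub : (C <= A :&: B)%MS by rewrite sub_capmx CA.
have {}sub : (A :&: B <= C)%MS.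
  rewrite -(mxrank_leqif_sup sub) eqn_leq mxrankS //= rC -ltnS subn1 prednK //.
  by apply: capmx_rank_lt; rewrite ?AV ?BW.
apply/subsetP=> x; rewrite inE !mem_row_spanE -sub_capmx => /submx_trans; exact.
Qed.

(** The orthogonal complement for the standard dot product. It reverses inclusions, which turns a
    top into a family with a common subspace. *)
Definition perp n (V : {set 'rV[F]_n}) : {set 'rV[F]_n} :=
  [set x | [forall v in V, v *m x^T == 0]].

Lemma mem_perp_row_span k n (A : 'M[F]_(k, n)) x :
  (x \in perp (row_span A)) = (x *m A^T == 0).
Proof.
rewrite inE; apply/forall_inP/eqP=> [xA|xA _ /imsetP[y _ ->]].
  apply/trmx_inj; rewrite trmx_mul trmxK trmx0; apply/row_matrixP=> i.
  by rewrite row_mul row0; apply/eqP/xA/row_mem_row_span.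
by rewrite -mulmxA -[A]trmxK -trmx_mul xA trmx0 mulmx0.
Qed.

(** Rank-nullity for [x *m A^T], which is onto because [A] has a right inverse. *)
Lemma card_perp k n (V : {set 'rV[F]_n}) : subspace k V ->
  (#|F| ^ k * #|perp V|)%N = (#|F| ^ n)%N.
Proof.
case/subspaceP=> A /right_invertibleP[B AB] ->.
have surj (y : 'rV_k) : exists x, mulmxr A^T x = y.
  by exists (y *m B^T); rewrite /= -mulmxA -trmx_mul AB trmx1 mulmx1.
have := card_preimset_additive setT surj.
rewrite preimsetT !cardsT !card_mx !mul1n => ->; congr (_ * _)%N.
by apply: eq_card => x; rewrite mem_perp_row_span !inE.
Qed.

(** Distinct members add up to [Q], so their complements form a sunflower with core [perp Q]. *)
Lemma card_top_le m n (Q : {set 'rV[F]_n}) (K : {set {set 'rV[F]_n}}) :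
  (0 < m)%N -> subspace (m + 1) Q ->
  {in K, forall V : {set 'rV_n}, subspace m V && (V \subset Q)} ->
  (#|K| * (#|F| - 1) <= #|F| ^ (m + 1) - 1)%N.
Proof.
move=> m_gt0 sQ KQ.
have q_gt0 : (0 < #|F|)%N by apply/card_gt0P; exists 0.
have perp_gt0 : (0 < #|perp Q|)%N.
  apply/card_gt0P; exists 0; rewrite inE; apply/forall_inP=> v _.
  by rewrite trmx0 mulmx0.
(* Multiplying by [#|perp Q|] gives the sunflower form: [perp V] has [#|F| * #|perp Q|] elements. *)
rewrite -(leq_pmul2r perp_gt0) -mulnA !mulnBl mul1n (card_perp sQ).
have -> : (#|F| ^ n)%N = #|{: 'rV[F]_n}| by rewrite card_mx mul1n.
apply: (card_sunflower_le (f := @perp n)) => [V|V|V W].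
- case/KQ/andP=> _ /subsetP VQ; apply/subsetP=> x; rewrite !inE.
  by move=> /forall_inP xQ; apply/forall_inP=> v /VQ/xQ.
- case/KQ/andP=> sV _; apply/eqP.
  rewrite -(eqn_pmul2l (m := #|F| ^ m)) ?expn_gt0 ?q_gt0 //.
  by rewrite (card_perp sV) mulnA -expnSr -addn1 (card_perp sQ).
move=> /KQ/andP[sV VQ] /KQ/andP[sW WQ] VW.
have [rA AV] := matrix_rep_fieldP sV; have [rB BW] := matrix_rep_fieldP sW.
have [rC CQ] := matrix_rep_fieldP sQ.
move: (matrix_rep m V) (matrix_rep m W) (matrix_rep _ Q) rA AV rB BW rC CQ.
move=> A B C rA AV rB BW rC CQ.
move: VQ WQ; rewrite -CQ -AV -BW !row_span_subE => AC BC.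
have CAB : (C <= A + B)%MS.
  have sub : (A + B <= C)%MS by rewrite addsmx_sub AC.
  rewrite -(mxrank_leqif_sup sub) eqn_leq mxrankS //= rC addn1.
  have : (\rank (A :&: B) < m)%N by apply: capmx_rank_lt; rewrite ?AV ?BW.
  have := mxrank_sum_cap A B; rewrite rA rB => sE.
  by rewrite -(ltn_add2l m) -sE ltn_add2r.
apply/subsetP=> x; rewrite inE !mem_perp_row_span => /andP[/eqP xA /eqP xB].
have /sub_addsmxP[[u v] /= ->] := CAB.
by rewrite linearD /= !trmx_mul mulmxDr !mulmxA xA xB !mul0mx addr0.
Qed.

End FiniteField.

(** * Cliques over a local ring *)


Section LocalCliques.

Variables (R : finComUnitRingType) (F : finFieldType) (pi : {rmorphism R -> F}).
Hypothesis pi_surj : forall y, exists x, pi x = y.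
Hypothesis pi_unit : forall x, pi x != 0 -> x \is a GRing.unit.

Variables m N : nat.
Hypothesis m_gt0 : (0 < m)%N.

Local Notation q := #|F|.
Local Notation i := #|[set x | pi x == 0%R]|.
Local Notation piV V := [set map_mx pi x | x in V].
Local Notation cliqueR M :=
  (clique (grass_vertices R (m + N) m) (grass_adj m) M).
Local Notation cliqueF K :=
  (clique (grass_vertices F (m + N) m) (grass_adj m) K).

Let q_gt0 : (0 < q)%N.
Proof. by apply/card_gt0P; exists 0. Qed.

Let i_gt0 : (0 < i)%N.
Proof. by apply/card_gt0P; exists 0; rewrite inE rmorph0. Qed.

Let expB a : (q ^ (m + a) - q ^ (m - 1) = (q ^ (a + 1) - 1) * q ^ (m - 1))%N.
Proof. by rewrite mulnBl mul1n -expnD -addnA subnKC // addnC. Qed.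

Let expB0 : (q ^ m - q ^ (m - 1) = (q - 1) * q ^ (m - 1))%N.
Proof. by have := expB 0; rewrite addn0 expn1. Qed.

Lemma pi_subspace k n (V : {set 'rV[R]_n}) : subspace k V -> subspace k (piV V).
Proof.
case/subspaceP=> A rA ->; apply/subspaceP; exists (map_mx pi A).
  by rewrite right_invertible_pi.
exact: pi_row_span.
Qed.

(** Distinct reductions come from distinct members, whose common [(m - 1)]-subspace reduces to a
    common one. *)
Lemma pi_clique M : cliqueR M -> cliqueF [set piV V | V : {set _} in M].
Proof.
case/andP=> /subsetP sM /forall_inP adjM.
have {}sM V : V \in M -> subspace m V by move/sM; rewrite inE.
apply/andP; split.
  by apply/subsetP=> _ /imsetP[V VM ->]; rewrite inE pi_subspace ?sM.
apply/forall_inP=> _ /imsetP[V VM ->]; apply/forall_inP=> _ /imsetP[W WM ->].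
apply/implyP=> VW; have neqVW : V != W by apply: contraNneq VW => ->.
move/implyP: (forall_inP (adjM V VM) W WM) => /(_ neqVW).
case/(grass_adjP m_gt0 (sM V VM) (sM W WM) neqVW) => C rC [CV CW].
apply/grass_adjP => //; try by rewrite pi_subspace ?sM.
exists (map_mx pi C); first by rewrite right_invertible_pi.
by rewrite -(pi_row_span pi_surj) !imsetS.
Qed.

Lemma card_clique_pi M (T : 'I_m -> 'M[F]_N) :
  (forall u : 'cV_m, u != 0 -> \sum_i u i 0 *: T i \in unitmx) ->
  cliqueR M -> (#|M| <= #|[set piV V | V : {set _} in M]| * i ^ N)%N.
Proof.
move=> T_unit /[dup] cM /andP[/subsetP sM /forall_inP adjM].
rewrite -sum1_card (partition_big (fun V : {set _} => piV V)
  (mem [set piV V | V : {set _} in M])) /= => [|V VM]; last exact: imset_f.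
rewrite -sum_nat_const; apply: leq_sum => U _.
rewrite sum1_card -cardsE.
apply: (card_clique_fiber pi_surj pi_unit m_gt0 T_unit (U := U)); last first.
  by move=> V; rewrite inE => /andP[_ /eqP].
apply/andP; split.
  by apply/subsetP=> V; rewrite inE => /andP[/sM].
apply/forall_inP=> V; rewrite inE => /andP[VM _].
apply/forall_inP=> W; rewrite inE => /andP[WM _].
exact: (forall_inP (adjM V VM)).
Qed.

(** The clique is a star over [R]. Its size is bounded below by covering: the members must contain
    every vector of [U], and each contains few of them. *)
Lemma exists_large_clique : exists2 M, cliqueR M &
  (i ^ N * (q ^ (N + 1) - 1) <= #|M| * (q - 1))%N.
Proof.
have mn : (m - 1 <= m + N)%N by rewrite (leq_trans (leq_subr _ _)) ?leq_addr.
pose C : 'M[R]_(m - 1, m + N) := rowsub (widen_ord mn) 1%:M.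
have rC : right_invertible C.
  apply: rowsub_right_invertible => [a b /(congr1 val)/= /val_inj //|].
  by rewrite right_invertible_unit unitmx1.
have rpC : right_invertible (map_mx pi C) by rewrite right_invertible_pi.
have cpC : #|row_span (map_mx pi C)| = (q ^ (m - 1))%N.
  by apply: card_subspace; apply/subspaceP; exists (map_mx pi C).
pose M := [set V in grass_vertices R (m + N) m | row_span C \subset V].
have MP V : V \in M -> subspace m V /\ row_span C \subset V.
  by rewrite !inE => /andP[].
exists M.
  apply/andP; split; first by apply/subsetP=> V; rewrite inE => /andP[].
  apply/forall_inP=> V /MP[sV CV]; apply/forall_inP=> W /MP[sW CW].
  by apply/implyP=> VW; apply/grass_adjP => //; exists C.
pose U := [set v : 'rV_(m + N) | map_mx pi v \in ~: row_span (map_mx pi C)].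
have cU : #|U| = ((q ^ (m + N) - q ^ (m - 1)) * i ^ (m + N))%N.
  by rewrite card_pi_preim // cardsCs setCK cpC card_mx mul1n.
have UV V : V \in M -> (#|U :&: V| <= (q ^ m - q ^ (m - 1)) * i ^ m)%N.
  case/MP=> /subspaceP[A rA ->] CA.
  have rpA : right_invertible (map_mx pi A) by rewrite right_invertible_pi.
  (* Coordinates, in the basis [map_mx pi A], of vectors outside the reduced core; vectors of [U] in
     the member have coordinates reducing into [S]. *)
  pose S := ~: [set y : 'rV[F]_m | y *m map_mx pi A \in row_span (map_mx pi C)].
  have cS : #|S| = (q ^ m - q ^ (m - 1))%N.
    rewrite cardsCs setCK card_mx mul1n -cpC; congr (_ - _)%N.
    rewrite -(card_imset _ (right_invertible_inj rpA)); apply: eq_card => x.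
    apply/imsetP/idP=> [[y + ->]|xC]; first by rewrite inE.
    have /imsetP[y _ xE] : x \in row_span (map_mx pi A).
      by move: xC; apply/subsetP; rewrite -!pi_row_span // imsetS.
    by exists y; rewrite // inE -xE.
  rewrite -cS -card_pi_preim // -(card_imset _ (right_invertible_inj rA)).
  apply/subset_leq_card/subsetP=> x /setIP[xU /imsetP[y _ xE]].
  by move: xU; rewrite xE !inE map_mxM => yC; apply: imset_f; rewrite !inE.
have leU : (#|U| <= \sum_(V in M) #|U :&: V|)%N.
  have UVE V : #|U :&: V| = (\sum_(v in U) (v \in V))%N.
    rewrite -sum1_card big_mkcond [RHS]big_mkcond; apply: eq_bigr => v _.
    by rewrite inE; case: (v \in U); case: (v \in V).
  rewrite (eq_bigr _ (fun V _ => UVE V)) exchange_big -sum1_card leq_sum // => v.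
  (* The member through [v] is spanned by [C] and [v]; unimodularity is checked after reduction,
     where [v] raises the rank by one. *)
  rewrite /U !inE => vU; pose V := row_span (col_mx C v).
  have VM : V \in M.
    rewrite !inE; apply/andP; split; last first.
      apply/row_span_sub; exists (row_mx 1%:M 0).
      by rewrite mul_row_col mul1mx mul0mx addr0.
    rewrite -[X in subspace X](subnK m_gt0); apply/subspaceP.
    exists (col_mx C v) => //; rewrite -(right_invertible_pi pi_surj pi_unit).
    rewrite right_invertible_row_free -row_leq_rank map_col_mx -addsmxE.
    move: rpC; rewrite right_invertible_row_free => /eqP {1}<-.
    rewrite addn1 (ltn_leqif (mxrank_leqif_sup (addsmxSl _ _))).
    apply: contra vU; rewrite mem_row_spanE; apply: submx_trans.
    exact: addsmxSr.
  rewrite (bigD1 V) //= (_ : v \in V) // -[v](_ : row_mx 0 1%:M *m col_mx C v = v).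
    exact: mem_row_span.
  by rewrite mul_row_col mul0mx mul1mx add0r.
have := leq_trans leU (leq_sum _ UV).
(* The common factor [q ^ (m - 1) * i ^ m] is then cancelled. *)
rewrite cU sum_nat_const expB expB0 (expnD _ m N).
have eqL a b c d : (a * b * (c * d) = (d * a) * (b * c))%N.
  by rewrite [(c * d)%N]mulnC mulnACA [(a * d)%N]mulnC.
rewrite eqL -[((q - 1) * _ * _)%N]mulnA [X in (_ <= X)%N]mulnA.
by rewrite leq_pmul2r // muln_gt0 !expn_gt0 q_gt0 i_gt0.
Qed.

Variable T : 'I_m -> 'M[F]_N.
Hypothesis T_unit : forall u : 'cV_m, u != 0 -> \sum_i u i 0 *: T i \in unitmx.
Hypothesis mN : (m <= N)%N.

Let star_le (P : {set 'rV[F]_(m + N)}) (K : {set {set 'rV[F]_(m + N)}}) :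
  subspace (m - 1) P ->
  {in K, forall V : {set 'rV_(m + N)}, subspace m V && (P \subset V)} ->
  (#|K| * (q - 1) <= q ^ (N + 1) - 1)%N.
Proof.
move=> sP /(card_star_le m_gt0 sP).
rewrite expB expB0 mulnA.
by rewrite leq_pmul2r // expn_gt0 q_gt0.
Qed.

(** Here [b] is [(q ^ (N + 1) - 1) / (q - 1)], the number of members of a full star over [F],
    specified without division. *)
Lemma clique_number_local b : (b * (q - 1) = q ^ (N + 1) - 1)%N ->
  grass_clique_number R (m + N) m = (i ^ N * b)%N /\
  forall M, grass_maximum_clique m M ->
    let piM := [set piV V | V : {set 'rV[R]_(m + N)} in M] in
    ((m < N)%N -> is_star m piM) /\ (is_star m piM \/ is_top m piM).
Proof.
move=> bE.
have q1_gt0 : (0 < q - 1)%N by rewrite subn_gt0 finNzRing_gt1.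
have cliqueFP K : cliqueF K -> K != set0 ->
    (exists2 P, subspace (m - 1) P & {in K, forall V : {set _}, P \subset V}) \/
    (exists2 Q, subspace (m + 1) Q & {in K, forall V : {set _}, V \subset Q}).
  exact: clique_sub_star_or_top.
(* Tops are compared with stars through [m <= N]; strictness when [m < N] later excludes them. *)
have top_le (Q : {set 'rV[F]_(m + N)}) (K : {set {set 'rV[F]_(m + N)}}) :
    subspace (m + 1) Q ->
    {in K, forall V : {set 'rV_(m + N)}, subspace m V && (V \subset Q)} ->
    (#|K| <= b)%N /\ ((m < N)%N -> (#|K| < b)%N).
  move=> sQ /(card_top_le m_gt0 sQ) le; split=> [|ltmN].
    rewrite -(leq_pmul2r q1_gt0) bE (leq_trans le) // leq_sub2r //.
    by rewrite leq_pexp2l // leq_add2r.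
  rewrite -(ltn_pmul2r q1_gt0) bE (leq_ltn_trans le) // ltn_sub2r //.
    by rewrite -{1}(expn0 q) ltn_exp2l ?finNzRing_gt1 // addn1.
  by rewrite ltn_exp2l ?finNzRing_gt1 // ltn_add2r.
have star_leb P (K : {set {set 'rV[F]_(m + N)}}) : subspace (m - 1) P ->
    {in K, forall V : {set 'rV_(m + N)}, subspace m V && (P \subset V)} ->
    (#|K| <= b)%N.
  by move=> sP KP; rewrite -(leq_pmul2r q1_gt0) bE (star_le sP).
have cliqueF_le K : cliqueF K -> (#|K| <= b)%N.
  move=> cK; have [->|nzK] := eqVneq K set0; first by rewrite cards0.
  have sK V : V \in K -> subspace m V.
    by case/andP: cK => /subsetP/(_ V); rewrite inE.
  case: (cliqueFP K cK nzK) => [[P sP PK]|[Q sQ QK]].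
    by apply: (star_leb _ _ sP) => V VK; rewrite sK ?PK.
  by apply: (proj1 (top_le _ _ sQ _)) => V VK; rewrite sK ?QK.
have cN : grass_clique_number R (m + N) m = (i ^ N * b)%N.
  apply/eqP; rewrite eqn_leq; apply/andP; split.
    apply/bigmax_leqP=> M cM; apply: leq_trans (card_clique_pi T_unit cM) _.
    by rewrite mulnC leq_mul2l cliqueF_le ?orbT ?pi_clique.
  have [M cM leM] := exists_large_clique.
  apply: (bigmax_sup M) => //.
  by rewrite -(leq_pmul2r q1_gt0) -mulnA bE.
split=> // M /andP[cM /eqP cardM] piM.
have b_gt0 : (0 < b)%N.
  rewrite -(ltn_pmul2r q1_gt0) bE mul0n subn_gt0 -{1}(expn0 q).
  by rewrite ltn_exp2l ?finNzRing_gt1 // addn1.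
have cpiM : cliqueF piM := pi_clique cM.
(* Cancelling [i ^ N] from the fibre bound for a maximum clique. *)
have bM : (b <= #|piM|)%N.
  have := card_clique_pi T_unit cM; rewrite cardM -/(grass_clique_number _ _ _).
  by rewrite cN mulnC leq_pmul2r // expn_gt0 i_gt0.
have nzM : piM != set0 by rewrite -card_gt0 (leq_trans b_gt0).
have sM V : V \in piM -> subspace m V.
  by case/andP: cpiM => /subsetP/(_ V); rewrite inE.
case: (cliqueFP _ cpiM nzM) => [[P sP PM]|[Q sQ QM]].
  suff st : is_star m piM by split=> //; left.
  (* The whole star has at most [b] members, so [piM] fills it. *)
  exists P => //; apply/eqP; rewrite eqEcard; apply/andP; split.
    by apply/subsetP=> V VM; rewrite !inE sM ?PM.
  by apply: leq_trans bM; apply: (star_leb _ _ sP) => V; rewrite !inE.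
have [_ ltb] := top_le Q piM sQ
  (fun V VM => introT andP (conj (sM V VM) (QM V VM))).
split=> [/ltb|]; first by rewrite ltnNge bM.
right; exists Q => //; apply/eqP; rewrite eqEcard; apply/andP; split.
  by apply/subsetP=> V VM; rewrite !inE sM ?QM.
by apply: leq_trans bM; apply: (proj1 (top_le _ _ sQ _)) => V; rewrite !inE.
Qed.

End LocalCliques.

(** * Reduction modulo p *)


Section ReductionModP.

Variables p s : nat.
Hypotheses (p_pr : prime p) (s_gt0 : (0 < s)%N).

Let p_gt1 : (1 < p)%N. Proof. exact: prime_gt1. Qed.

Let ps_gt1 : (1 < p ^ s)%N.
Proof. by rewrite -{1}(expn0 p) ltn_exp2l. Qed.

(** The target is ['F_p], that is ['Z_(pdiv p)], for its field structure; [pdiv_id] later brings the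
    result back to ['Z_p]. *)
Definition reduceF (x : 'Z_(p ^ s)) : 'F_p := (x : nat)%:R.

Let natr_modps a : (a %% (Zp_trunc (p ^ s)).+2)%:R = a%:R :> 'F_p.
Proof.
by rewrite (Zp_cast ps_gt1) -Fp_nat_mod // modn_dvdm ?Fp_nat_mod // dvdn_exp.
Qed.

Lemma reduceF_zmod_morphism : zmod_morphism reduceF.
Proof.
move=> x y; apply/eqP; rewrite eq_sym subr_eq; apply/eqP.
by rewrite -{1}(subrK y x) /reduceF /= natr_modps natrD.
Qed.

Lemma reduceF_monoid_morphism : monoid_morphism reduceF.
Proof.
split=> [|x y]; last by rewrite /reduceF /= natr_modps natrM.
by rewrite /reduceF /= natr_modps.
Qed.

Definition reduceF_rmorphism : {rmorphism 'Z_(p ^ s) -> 'F_p} :=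
  HB.pack reduceF
    (GRing.isZmodMorphism.Build 'Z_(p ^ s) 'F_p reduceF reduceF_zmod_morphism)
    (GRing.isMonoidMorphism.Build 'Z_(p ^ s) 'F_p reduceF
       reduceF_monoid_morphism).

Lemma reduceF_surj y : exists x, reduceF_rmorphism x = y.
Proof.
exists (y : nat)%:R.
by rewrite -[RHS]natr_Zp; apply: (rmorph_nat reduceF_rmorphism).
Qed.

(** An integer not divisible by the prime [p] is coprime to [p ^ s]. *)
Lemma reduceF_unit x : reduceF_rmorphism x != 0 -> x \is a GRing.unit.
Proof.
rewrite -[x in X in _ -> X]natr_Zp unitZpE // coprime_pexpl // prime_coprime //.
apply: contra => /dvdnP[k xE]; rewrite /= /reduceF xE natrM.
by rewrite pchar_Fp_0 // mulr0.
Qed.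

Lemma card_reduceF_ker : #|[set x | reduceF x == 0%R]| = (p ^ (s - 1))%N.
Proof.
have cZ : #|'Z_(p ^ s)| = (p ^ s)%N by rewrite card_ord Zp_cast.
apply/eqP; rewrite -(eqn_pmul2l (prime_gt0 p_pr)) -expnS -subSn // subn1 /=.
rewrite -[X in (X * _)%N](card_Fp p_pr).
by rewrite -(card_pi reduceF_surj) cZ.
Qed.

End ReductionModP.

Theorem theorem4p4 (p s n m : nat) (p_pr : prime p) (s_ge1 : (1 <= s)%N)
    (n_ge2m : (2 * m <= n)%N) (m2_ge4 : (4 <= 2 * m)%N) :
  (grass_clique_number 'Z_(p ^ s) n m)%:R
    = (p ^ ((s - 1) * (n - m)))%:R * gauss_binom p (n - m + 1) 1 :> rat
  /\
  (forall M : {set {set 'rV['Z_(p ^ s)]_n}},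
    grass_maximum_clique m M ->
    let piM : {set {set 'rV['Z_p]_n}} :=
      [set reduce_subspace m A | A in M] in
    ((2 * m < n)%N -> is_star m piM) /\
    (n = (2 * m)%N -> is_star m piM \/ is_top m piM)).
Proof.
have m_gt0 : (0 < m)%N by case: (m) m2_ge4.
have p_gt1 := prime_gt1 p_pr.
have [N nE] : exists N, n = (m + N)%N.
  by exists (n - m)%N; rewrite subnKC // (leq_trans _ n_ge2m) // leq_pmull.
subst n; rewrite addKn.
have mN : (m <= N)%N by move: n_ge2m; rewrite mul2n -addnn leq_add2l.
have N_gt0 : (0 < N)%N := leq_trans m_gt0 mN.
have [T T_unit] := nonsingular_pencil p_pr N_gt0 mN.
(* The geometric sum is the quotient required of [b]. *)
pose b := (\sum_(k < N + 1) p ^ k)%N.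
have bE : (b * (p - 1) = p ^ (N + 1) - 1)%N.
  by rewrite !subn1 predn_exp mulnC.
have [] := clique_number_local (reduceF_surj p_pr s_ge1)
  (@reduceF_unit p s p_pr s_ge1) m_gt0 T_unit mN (b := b).
  by rewrite card_Fp.
rewrite [X in (X ^ N)%N](card_reduceF_ker p_pr s_ge1) => cN maxM.
split.
  rewrite cN natrM -expnM; congr (_ * _).
  rewrite /gauss_binom big_nat1 expr1 addnK.
  have nz : (p%:R - 1 : rat) != 0.
    by rewrite subr_eq0 -[1]/(1%:R) (Num.Theory.eqr_nat _ p 1) gtn_eqF.
  apply: (mulIf nz); rewrite divfK //.
  have := congr1 (fun k => k%:R : rat) bE.
  by rewrite natrM !natrB ?expn_gt0 ?(ltnW p_gt1) // natrX.
move=> M maxMM piM.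
(* The modulus is abstracted as [q], so that [p] can be replaced by [pdiv p] in all the types at
   once. *)
pose red q (x : 'Z_(p ^ s)) : 'Z_q := (x : nat)%:R.
pose K q := [set row_span (map_mx (red q) (matrix_rep m V)) | V in M].
pose starTop q := ((m < N)%N -> @is_star 'Z_q (m + N) m (K q)) /\
  (@is_star 'Z_q (m + N) m (K q) \/ @is_top 'Z_q (m + N) m (K q)).
suff [star starVtop] : starTop p.
  by split=> [|_]; rewrite // mul2n -addnn ltn_add2l.
rewrite -(pdiv_id p_pr); suff KE : K (pdiv p) =
    [set [set map_mx (reduceF_rmorphism p_pr s_ge1) x | x in V] |
       V : {set 'rV['Z_(p ^ s)]_(m + N)} in M].
  by rewrite /starTop KE; apply: maxM.
apply: eq_in_imset => V VM; have sV : subspace m V.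
  by case/andP: maxMM => /andP[/subsetP/(_ V VM)]; rewrite inE.
have [_ VE] := matrix_repP sV.
(* The row span of the reduced representative is the entrywise image of [V]. *)
by rewrite -[in RHS]VE pi_row_span //; apply: reduceF_surj.
Qed.
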